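(* A graph $G$ has a sequential embedding in $\mathbb{R}^d$ if and only if $G$ is $2^d$-colorable.
   Context: Here $d$ is the dimension of the ambient Euclidean space $\mathbb{R}^d$. A (not necessarily planar) embedding of a graph $G$ in $\mathbb{R}^d$, in which distinct vertices are placed at distinct points and edges are allowed to cross, is called sequential if (i) the vertices of $G$ lie in $\mathbb{Z}^d$ and (ii) the line segments between adjacent vertices in $G$ contain no interior integer points (that is, no points of $\mathbb{Z}^d$ other than the two endpoints). A graph is $2^d$-colorable if it has a proper vertex coloring (adjacent vertices receive different colors) using at most $2^d$ colors.
   Formalization: The equivalence is proved for finite simple graphs and d ≥ 2; it fails for d = 1 (the star K_{1,3} is 2-colorable but has no sequential embedding in R^1) and for d = 0 (two isolated vertices). *)

(* Defs.v *)
From HB Require Import structures.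
From mathcomp Require Import all_boot all_order all_algebra.
From mathcomp Require Import reals.

Set Implicit Arguments.
Unset Strict Implicit.
Unset Printing Implicit Defensive.

Import Order.TTheory GRing.Theory Num.Theory.

Local Open Scope ring_scope.

Definition simple_graph (V : finType) (adj : rel V) : Prop :=
  symmetric adj /\ irreflexive adj.

Definition colorable (V : finType) (adj : rel V) (k : nat) : Prop :=
  exists c : V -> 'I_k, forall u v : V, adj u v -> c u <> c v.

Definition integer_point (R : realType) (d : nat) (x : 'rV[R]_d) : Prop :=
  x \is a mxOver Num.int.

(* The closed segment [x, y]. *)
Definition in_segment (R : realType) (d : nat) (x y z : 'rV[R]_d) : Prop :=
  exists t : R, 0 <= t <= 1 /\ z = (1 - t) *: x + t *: y.

(* Edges are straight segments and are allowed to cross; only the placement of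
   the vertices is required to be injective. *)
Definition sequential_embedding (R : realType) (d : nat) (V : finType)
    (adj : rel V) (f : V -> 'rV[R]_d) : Prop :=
  [/\ injective f,
      forall v : V, integer_point (f v)
    & forall (u v : V) (z : 'rV[R]_d), adj u v ->
        in_segment (f u) (f v) z -> integer_point z -> z = f u \/ z = f v].

(* Main.v *)
(** Forward: the residues mod 2 of the coordinates give the coloring, since two
    integer points that are congruent mod 2 have an integer midpoint.

    Backward: identify the colors with 0/1-vectors [b], number the vertices and
    place the [i]-th one at [b + 6 i (1, 2, 0, ..., 0)].  Suppose that [t] times
    the difference [D] of two such points is an integer vector, and let [delta]
    be the difference of their 0/1-vectors.  Since
    [D_2 - 2 D_1 = delta_2 - 2 delta_1] has absolute value at most 3, it is zero,
    and then [delta_1 = delta_2 = 0], or it divides 6, and then [6 t] is an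
    integer.  Either way [t * delta] is integral, so [t] is an integer as soon as
    the colors differ. *)
Require Import Defs.
From mathcomp Require Import all_boot all_order all_algebra.
From mathcomp Require Import reals.
From mathcomp Require Import zify ring lra.

Set Implicit Arguments.
Unset Strict Implicit.
Unset Printing Implicit Defensive.

Import Order.TTheory GRing.Theory Num.Theory.

Local Open Scope ring_scope.

Section SequentialEmbedding.

Variable R : realType.

Lemma card_bool_vectors (d : nat) : #|{ffun 'I_d -> bool}| = (2 ^ d)%N.
Proof. by rewrite card_ffun card_bool card_ord. Qed.

Lemma colorable_bool_vectors (V : finType) (adj : rel V) (d : nat) :
  colorable adj (2 ^ d)%N <->
  exists b : V -> {ffun 'I_d -> bool}, forall u v, adj u v -> b u <> b v.
Proof.
rewrite -card_bool_vectors; split=> [[c cP]|[b bP]].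
- by exists (enum_val \o c) => u v /cP cuv /enum_val_inj.
- by exists (enum_rank \o b) => u v /bP buv /enum_rank_inj.
Qed.

(** At integer points [Num.floor] just recovers the integer coordinate, and the absolute value moves
    it to [nat] without changing its parity. *)
Definition parity (d : nat) (x : 'rV[R]_d) : {ffun 'I_d -> bool} :=
  [ffun j => odd `|Num.floor (x 0 j)|].

Lemma eq_parity_midpoint (d : nat) (x y : 'rV[R]_d) :
  integer_point x -> integer_point y -> parity x = parity y ->
  integer_point ((1 - 2^-1) *: x + 2^-1 *: y).
Proof.
move=> /mxOverP xint /mxOverP yint /ffunP exy.
apply/mxOverP => i j; rewrite !mxE (ord1 i).
move: (exy j); rewrite !ffunE.
move/intrP: (xint 0 j) => [m ->]; move/intrP: (yint 0 j) => [n ->].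
rewrite !intrKfloor => emn.
have [q mnq] : exists q : int, m + n = 2 * q.
  by exists ((m + n) %/ 2)%Z; lia.
suff -> : (1 - 2^-1) * m%:~R + 2^-1 * n%:~R = q%:~R :> R by exact: intr_int.
have : (m + n)%:~R = (2 * q)%:~R :> R by rewrite mnq.
rewrite intrD intrM => h; lra.
Qed.

Lemma sequential_embedding_parity (V : finType) (adj : rel V) (d : nat)
    (f : V -> 'rV[R]_d) (u v : V) :
  irreflexive adj -> sequential_embedding adj f -> adj u v ->
  parity (f u) <> parity (f v).
Proof.
move=> irr [finj fint fseq] uv epar.
have fuv : f u <> f v by move/finj => euv; rewrite euv irr in uv.
have midseg : in_segment (f u) (f v) ((1 - 2^-1) *: f u + 2^-1 *: f v).
  by exists 2^-1; split=> //; apply/andP; split; lra.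
have midint := eq_parity_midpoint (fint u) (fint v) epar.
(* A midpoint equal to either endpoint would make the two endpoints coincide. *)
apply: fuv; apply/rowP => j.
by have [] := fseq u v _ uv midseg midint => /rowP/(_ j); rewrite !mxE => h; lra.
Qed.

(** The vector from [x] to the point with parameter [t] is [t *: (y - x)]; it is integral, so [t] is
    an integer in [0, 1], that is, 0 or 1. *)
Lemma primitive_segment (d : nat) (x y z : 'rV[R]_d) :
  (forall t : R, integer_point (t *: (y - x)) -> t \is a Num.int) ->
  integer_point x -> in_segment x y z -> integer_point z -> z = x \/ z = y.
Proof.
move=> prim xint [t [/andP[t0 t1] ->]] zint.
have : t \is a Num.int.
  apply: prim; apply/mxOverP => i j.
  have -> : (t *: (y - x)) i j = ((1 - t) *: x + t *: y) i j - x i j.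
    by rewrite !mxE; ring.
  by rewrite rpredB //; [exact: (mxOverP zint) | exact: (mxOverP xint)].
move=> /intrP[m tm]; move: t0 t1; rewrite tm (ler0z R) (lerz1 R) => m0 m1.
have [->|->] : m = 0 \/ m = 1 by lia.
- by left; rewrite subr0 scale1r scale0r addr0.
- by right; rewrite subrr scale1r scale0r add0r.
Qed.

(** Subtracting twice the first product from the second eliminates [k] and leaves
    [t * (e2 - 2 * e1)]. *)
Lemma small_combination_int (t : R) (e1 e2 k : int) :
  `|e1| <= 1 -> `|e2| <= 1 ->
  t * (e1 + 6 * k)%:~R \is a Num.int -> t * (e2 + 12 * k)%:~R \is a Num.int ->
  t * e1%:~R \is a Num.int /\ t * e2%:~R \is a Num.int.
Proof.
move=> e1_le e2_le te1 te2.
have [c0|c_neq0] := eqVneq (e2 - 2 * e1) 0.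
  have [-> ->] : e1 = 0 /\ e2 = 0 by lia.
  by rewrite mulr0 rpred0.
(* Every nonzero integer of absolute value at most 3 divides 6, which explains the factor 6 in the
   placement. *)
have [q cq] : exists q : int, 6 = q * (e2 - 2 * e1).
  by exists (6 %/ (e2 - 2 * e1))%Z; have : e2 - 2 * e1 \in [:: -3; -2; -1; 1; 2; 3];
    rewrite !inE; lia.
have t6 : t * 6%:~R \is a Num.int.
  have -> : t * 6%:~R = q%:~R * (t * (e2 + 12 * k)%:~R
                                 - 2%:~R * (t * (e1 + 6 * k)%:~R)).
    by rewrite {1}cq !(intrM, intrD, intrB); ring.
  by rewrite rpredM ?intr_int // rpredB // rpredM ?intr_int.
split.
- have -> : t * e1%:~R = t * (e1 + 6 * k)%:~R - k%:~R * (t * 6%:~R).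
    by rewrite intrD intrM; ring.
  by rewrite rpredB // rpredM ?intr_int.
- have -> : t * e2%:~R = t * (e2 + 12 * k)%:~R - (2 * k)%:~R * (t * 6%:~R).
    by rewrite !(intrD, intrM); ring.
  by rewrite rpredB // rpredM ?intr_int.
Qed.

Section Placement.

Variables (V : finType) (d : nat) (b : V -> {ffun 'I_d.+2 -> bool}).

Definition direction (j : 'I_d.+2) : int :=
  match val j with 0 => 6 | 1 => 12 | _ => 0 end.

Definition coordinate (v : V) (j : 'I_d.+2) : int :=
  (b v j : nat)%:Z + direction j * (enum_rank v : nat)%:Z.

Definition placement (v : V) : 'rV[R]_d.+2 := \row_j (coordinate v j)%:~R.

Lemma placement_integer (v : V) : integer_point (placement v).
Proof. by apply/mxOverP => i j; rewrite mxE intr_int. Qed.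

(** The first coordinate suffices: it is 0 or 1 plus six times the number of the vertex, so it
    determines that number. *)
Lemma placement_inj : injective placement.
Proof.
move=> u v /rowP/(_ 0); rewrite !mxE => /eqP; rewrite eqr_int => /eqP.
rewrite /coordinate /direction /= => h; apply/enum_rank_inj/val_inj => /=.
by move: h; case: (b u 0); case: (b v 0) => /=; lia.
Qed.

Lemma placement_primitive (u v : V) (t : R) :
  b u <> b v -> integer_point (t *: (placement v - placement u)) ->
  t \is a Num.int.
Proof.
move=> buv /mxOverP tint.
pose e j : int := (b v j : nat)%:Z - (b u j : nat)%:Z.
pose k : int := (enum_rank v : nat)%:Z - (enum_rank u : nat)%:Z.
have e_le j : `|e j| <= 1 by rewrite /e; case: (b v j); case: (b u j).
have tD j : t * (e j + direction j * k)%:~R \is a Num.int.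
  move: (tint 0 j); rewrite !mxE -intrB /coordinate.
  by congr (t * _%:~R \is a Num.int); rewrite /e /k; ring.
(* The first two coordinates come from eliminating [k]; in the others [direction] vanishes and [tD]
   is already the claim. *)
have te j : t * (e j)%:~R \is a Num.int.
  have [te0 te1] :=
    small_combination_int (e_le ord0) (e_le (lift ord0 ord0)) (tD _) (tD _).
  have := tD j; rewrite /direction.
  case: j => [[|[|j]] jlt] /=.
  - by move=> _; rewrite (_ : Ordinal jlt = ord0) //; apply: val_inj.
  - move=> _; rewrite (_ : Ordinal jlt = lift ord0 ord0) //.
    exact: val_inj.
  - by rewrite mul0r addr0.
have [j buvj] : exists j, b u j != b v j.
  apply/existsP; rewrite -[[exists _, _]]negbK negb_exists; apply/negP.
  by move=> /forallP buv_eq; apply/buv/ffunP => j; apply/eqP/negPn/buv_eq.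
(* Where the colors differ, [e j] is 1 or -1, so [te j] is the claim up to sign. *)
have := te j; rewrite /e.
move: buvj; case: (b u j); case: (b v j) => //= _.
- by rewrite sub0r rmorphN /= mulrN mulr1 rpredN.
- by rewrite subr0 mulr1.
Qed.

Lemma placement_sequential (adj : rel V) :
  (forall u v, adj u v -> b u <> b v) -> sequential_embedding adj placement.
Proof.
move=> bP; split.
- exact: placement_inj.
- exact: placement_integer.
- move=> u v z /bP buv; apply: primitive_segment (placement_integer u).
  by move=> t; exact: placement_primitive.
Qed.

End Placement.

End SequentialEmbedding.

Theorem corollary2p3 (R : realType) (d : nat) (hd : (2 <= d)%N)
    (V : finType) (adj : rel V) (hG : simple_graph adj) :
  (exists f : V -> 'rV[R]_d, sequential_embedding adj f) <->
  colorable adj (2 ^ d)%N.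
Proof.
rewrite colorable_bool_vectors; split=> [[f fP]|].
- exists (fun v => parity (f v)) => u v.
  exact: sequential_embedding_parity hG.2 fP.
(* The placement needs two coordinates to run along, hence the form [d.+2]. *)
- case: d hd => [|[|d]] // _ [b bP].
  by exists (placement R b); exact: placement_sequential.
Qed.
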